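(* Let $r=s$ and let $\bar l_{i,s-1}(\tau)$, $i=1,\dots,s$, denote the Lagrange polynomials of degree $s-1$ associated with the quadrature points $0\le c_1<\dots<c_s\le1$. Moreover, let the weights $\alpha_i$ be given by $$\alpha_i=\int_0^1\bar l_{i,s-1}(\tau)\,d\tau,$$ and assume $\alpha_i\ne0$ for $i=1,\dots,s$. Then the stochastic Galerkin Hamiltonian variational integrator (defined in the context, with $r=s$) is equivalent to the stochastic partitioned Runge--Kutta method $$Q_i=q_k+\Delta t\sum_{j=1}^sa_{ij}\frac{\partial H}{\partial p}(Q_j,P_j)+\Delta W\sum_{j=1}^sb_{ij}\frac{\partial h}{\partial p}(Q_j,P_j),\quad i=1,\dots,s,$$ $$P_i=p_k-\Delta t\sum_{j=1}^s\bar a_{ij}\frac{\partial H}{\partial q}(Q_j,P_j)-\Delta W\sum_{j=1}^s\bar b_{ij}\frac{\partial h}{\partial q}(Q_j,P_j),\quad i=1,\dots,s,$$ $$q_{k+1}=q_k+\Delta t\sum_{i=1}^s\alpha_i\frac{\partial H}{\partial p}(Q_i,P_i)+\Delta W\sum_{i=1}^s\beta_i\frac{\partial h}{\partial p}(Q_i,P_i),$$ $$p_{k+1}=p_k-\Delta t\sum_{i=1}^s\alpha_i\frac{\partial H}{\partial q}(Q_i,P_i)-\Delta W\sum_{i=1}^s\beta_i\frac{\partial h}{\partial q}(Q_i,P_i),$$ with the coefficients $$a_{ij}=\int_0^{c_i}\bar l_{j,s-1}(\tau)\,d\tau,\qquad\bar a_{ij}=\frac{\alpha_j(\alpha_i-a_{ji})}{\alpha_i},\qquad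 b_{ij}=\frac{\beta_ja_{ij}}{\alpha_j},\qquad\bar b_{ij}=\frac{\beta_j(\alpha_i-a_{ji})}{\alpha_i},$$ for $i,j=1,\dots,s$.
   Context: $Q\cong\mathbb{R}^N$, $T^*Q=Q\times Q^*\cong\mathbb{R}^N\times\mathbb{R}^N$ with canonical coordinates $(q,p)$. $W(t)$ is a standard one-dimensional Wiener process; $t_k=k\Delta t$, $\Delta t>0$, and $\Delta W=W(t_{k+1})-W(t_k)$. The Hamiltonians $H,h:T^*Q\to\mathbb{R}$ (time-independent) are $C^2$, and the coefficients $A,B$ of the It\^o form $dz=A(z)dt+B(z)dW(t)$, $z=(q,p)$, of the system $dq=\frac{\partial H}{\partial p}dt+\frac{\partial h}{\partial p}\circ dW(t)$, $dp=-\frac{\partial H}{\partial q}dt-\frac{\partial h}{\partial q}\circ dW(t)$ (with $\circ$ denoting Stratonovich integration) are globally Lipschitz. Let $s\ge1$, control points $0=d_0<d_1<\dots<d_s=1$, and $l_{\mu,s}(\tau)$, $\mu=0,\dots,s$, the corresponding Lagrange polynomials of degree $s$, $l_{\mu,s}(d_\nu)=\delta_{\mu\nu}$; $\dot l_{\mu,s}$ is the derivative with respect to the argument. For control values $q^0,\dots,q^s\in Q$ put $$q_d(t_k+\tau\Delta t)=\sum_{\mu=0}^sq^\mu l_{\mu,s}(\tau),\qquad\dot q_d(t_k+\tau\Delta t)=\frac1{\Delta t}\sum_{\mu=0}^sq^\mu\dot l_{\mu,s}(\tau).$$ Let $(\alpha_i,c_i)_{i=1}^r$ and $(\beta_i,c_i)_{i=1}^r$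 be quadrature rules with points $0\le c_1<\dots<c_r\le1$ and weights $\alpha_i,\beta_i$. The stochastic Galerkin Hamiltonian variational integrator is the one-step scheme $(q_k,p_k)\mapsto(q_{k+1},p_{k+1})$ defined implicitly, with $q^0=q_k$ and unknowns $q^1,\dots,q^s\in Q$, $P_1,\dots,P_r\in Q^*$, by $$-p_k=\sum_{i=1}^r\alpha_i\Big[P_i\dot l_{0,s}(c_i)-\Delta t\frac{\partial H}{\partial q}[i]\,l_{0,s}(c_i)\Big]-\Delta W\sum_{i=1}^r\beta_i\frac{\partial h}{\partial q}[i]\,l_{0,s}(c_i),$$ $$0=\sum_{i=1}^r\alpha_i\Big[P_i\dot l_{\mu,s}(c_i)-\Delta t\frac{\partial H}{\partial q}[i]\,l_{\mu,s}(c_i)\Big]-\Delta W\sum_{i=1}^r\beta_i\frac{\partial h}{\partial q}[i]\,l_{\mu,s}(c_i),\quad\mu=1,\dots,s-1,$$ $$p_{k+1}=\sum_{i=1}^r\alpha_i\Big[P_i\dot l_{s,s}(c_i)-\Delta t\frac{\partial H}{\partial q}[i]\,l_{s,s}(c_i)\Big]-\Delta W\sum_{i=1}^r\beta_i\frac{\partial h}{\partial q}[i]\,l_{s,s}(c_i),$$ $$\alpha_i\dot q_d(t_k+c_i\Delta t)=\alpha_i\frac{\partial H}{\partial p}[i]+\beta_i\frac{\Delta W}{\Delta t}\frac{\partial h}{\partial p}[i],\quad i=1,\dots,r,$$ $$q_{k+1}=q^s,$$ where $[i]$ means evaluation at $\big(q_d(t_k+c_i\Delta t),P_i\big)$. In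 the Runge--Kutta method, $Q_i$ and $P_i$ are the position and momentum internal stages; they correspond to $Q_i=q_d(t_k+c_i\Delta t)$ and to the $P_i$ of the variational integrator. ''Equivalent'' means that the two systems of equations define the same scheme $(q_k,p_k)\mapsto(q_{k+1},p_{k+1})$ under this correspondence. *)

(* Defs.v *)
From HB Require Import structures.
From mathcomp Require Import all_boot all_order all_algebra.
From mathcomp Require Import all_classical all_reals all_analysis.

Set Implicit Arguments.
Unset Strict Implicit.
Unset Printing Implicit Defensive.

Import Order.TTheory GRing.Theory Num.Theory.
Import numFieldNormedType.Exports.

Local Open Scope classical_set_scope.
Local Open Scope ring_scope.

(* [Q] and its dual are both written as row vectors in canonical coordinates. *)
Notation phase R N := ('rV[R]_N * 'rV[R]_N)%type.

(* [normal_prob m sigma] takes the standard deviation, not the variance.  The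
   values [W t] at negative times play no role. *)
Record standard_wiener (R : realType) (disp : measure_display)
    (Omega : measurableType disp) (Pr : probability Omega R)
    (W : R -> {RV Pr >-> R}) : Prop := StandardWiener {
  wiener_start : {ae Pr, forall omega, W 0 omega = 0} ;
  wiener_increments : forall s t : R, 0 <= s -> s < t ->
    forall B : set R, measurable B ->
      Pr [set omega | B (W t omega - W s omega)] =
      normal_prob 0 (Num.sqrt (t - s)) B ;
  wiener_independent : forall (n : nat) (t : nat -> R) (B : nat -> set R),
    0 <= t 0%N -> (forall i, (i < n)%N -> t i < t i.+1) ->
    (forall i, measurable (B i)) ->
      Pr (\bigcap_(i < n) [set omega | B i (W (t i.+1) omega - W (t i) omega)])
      = (\prod_(i < n)
           Pr [set omega | B i (W (t i.+1) omega - W (t i) omega)%R])%E ;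
  wiener_continuous : {ae Pr, forall omega,
    {within `[0, +oo[, continuous (fun t : R => W t omega)}}
}.

Definition wiener_increment (R : realType) (disp : measure_display)
    (Omega : measurableType disp) (Pr : probability Omega R)
    (W : R -> {RV Pr >-> R}) (dt : R) (k : nat) (omega : Omega) : R :=
  W (k.+1%:R * dt) omega - W (k%:R * dt) omega.

Definition axis (R : realType) (N : nat) (i : 'I_N + 'I_N) : phase R N :=
  match i with
  | inl j => (delta_mx 0 j, 0)
  | inr j => (0, delta_mx 0 j)
  end.

Definition gradq (R : realType) (N : nat) (f : phase R N -> R)
    (z : phase R N) : 'rV[R]_N := \row_j 'D_(axis R (inl j)) f z.

Definition gradp (R : realType) (N : nat) (f : phase R N -> R)
    (z : phase R N) : 'rV[R]_N := \row_j 'D_(axis R (inr j)) f z.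

Definition C1 (R : realType) (N : nat) (f : phase R N -> R) : Prop :=
  forall i : 'I_N + 'I_N,
    (forall z, derivable f z (axis R i)) /\ continuous ('D_(axis R i) f).

Definition C2 (R : realType) (N : nat) (f : phase R N -> R) : Prop :=
  C1 f /\ forall i : 'I_N + 'I_N, C1 ('D_(axis R i) f).

Definition hamiltonian_field (R : realType) (N : nat) (f : phase R N -> R)
    (z : phase R N) : phase R N := (gradp f z, - gradq f z).

(* Stratonovich [dz = a(z) dt + b(z) o dW] has the Ito form
   [dz = (a + (1/2) Db . b)(z) dt + b(z) dW]. *)
Definition ito_drift (R : realType) (N : nat) (H h : phase R N -> R)
    (z : phase R N) : phase R N :=
  hamiltonian_field H z
  + 2^-1 *: 'D_(hamiltonian_field h z) (hamiltonian_field h) z.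

Definition ito_diffusion (R : realType) (N : nat) (h : phase R N -> R) :
    phase R N -> phase R N := hamiltonian_field h.

(* Nodes are indexed by ['I_n]; the library's [lagrange] (qpoly) takes an
   injective sequence [nat -> R] instead. *)
Definition lagrange_poly (R : realType) (n : nat) (x : 'I_n -> R)
    (i : 'I_n) : {poly R} :=
  \prod_(j < n | j != i) ((x i - x j)^-1 *: ('X - (x j)%:P)).

Lemma lagrange_poly_node (R : realType) (n : nat) (x : 'I_n -> R) :
  injective x -> forall i j, (lagrange_poly x i).[x j] = (i == j)%:R.
Proof.
move=> x_inj i j; rewrite /lagrange_poly horner_prod.
have [<-|ij] := eqVneq i j.
  rewrite big1 // => k ki; rewrite !hornerE mulVf // subr_eq0.
  by apply: contra_neq ki => /x_inj.
by rewrite (bigD1 j) 1?eq_sym //= !hornerE subrr mulr0 mul0r.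
Qed.

(* [qd d q tau] is [q_d(t_k + tau * dt)], and likewise for [dqd]. *)
Definition qd (R : realType) (N s : nat) (d : 'I_s.+1 -> R)
    (q : 'I_s.+1 -> 'rV[R]_N) (tau : R) : 'rV[R]_N :=
  \sum_(mu < s.+1) (lagrange_poly d mu).[tau] *: q mu.

Definition dqd (R : realType) (N s : nat) (d : 'I_s.+1 -> R) (dt : R)
    (q : 'I_s.+1 -> 'rV[R]_N) (tau : R) : 'rV[R]_N :=
  dt^-1 *: \sum_(mu < s.+1) (deriv (lagrange_poly d mu)).[tau] *: q mu.

Definition momentum_sum (R : realType) (N s r : nat) (H h : phase R N -> R)
    (d : 'I_s.+1 -> R) (alpha beta c : 'I_r -> R) (dt dW : R)
    (q : 'I_s.+1 -> 'rV[R]_N) (P : 'I_r -> 'rV[R]_N) (mu : 'I_s.+1) :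
    'rV[R]_N :=
  let l := lagrange_poly d mu in
  \sum_(i < r) alpha i *:
     ((deriv l).[c i] *: P i
      - (dt * l.[c i]) *: gradq H (qd d q (c i), P i))
  - dW *: \sum_(i < r) (beta i * l.[c i]) *: gradq h (qd d q (c i), P i).

Record galerkin_vi (R : realType) (N s r : nat) (H h : phase R N -> R)
    (d : 'I_s.+1 -> R) (alpha beta c : 'I_r -> R) (dt dW : R)
    (qk pk qk1 pk1 : 'rV[R]_N)
    (q : 'I_s.+1 -> 'rV[R]_N) (P : 'I_r -> 'rV[R]_N) : Prop := GalerkinVI {
  gvi_start : q ord0 = qk ;
  gvi_first : - pk = momentum_sum H h d alpha beta c dt dW q P ord0 ;
  gvi_inner : forall mu : 'I_s.+1, (0 < mu < s)%N ->
    0 = momentum_sum H h d alpha beta c dt dW q P mu ;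
  gvi_last : pk1 = momentum_sum H h d alpha beta c dt dW q P ord_max ;
  gvi_velocity : forall i : 'I_r,
    alpha i *: dqd d dt q (c i) =
    alpha i *: gradp H (qd d q (c i), P i)
    + (beta i * (dW / dt)) *: gradp h (qd d q (c i), P i) ;
  gvi_end : qk1 = q ord_max
}.

Definition galerkin_vi_step (R : realType) (N s r : nat)
    (H h : phase R N -> R) (d : 'I_s.+1 -> R) (alpha beta c : 'I_r -> R)
    (dt dW : R) (zk zk1 : phase R N) : Prop :=
  exists (q : 'I_s.+1 -> 'rV[R]_N) (P : 'I_r -> 'rV[R]_N),
    galerkin_vi H h d alpha beta c dt dW zk.1 zk.2 zk1.1 zk1.2 q P.

Record sprk (R : realType) (N s : nat) (H h : phase R N -> R)
    (a abar b bbar : 'I_s -> 'I_s -> R) (alpha beta : 'I_s -> R) (dt dW : R)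
    (qk pk qk1 pk1 : 'rV[R]_N) (Q P : 'I_s -> 'rV[R]_N) : Prop := SPRK {
  sprk_Q : forall i : 'I_s,
    Q i = qk + dt *: \sum_(j < s) a i j *: gradp H (Q j, P j)
             + dW *: \sum_(j < s) b i j *: gradp h (Q j, P j) ;
  sprk_P : forall i : 'I_s,
    P i = pk - dt *: \sum_(j < s) abar i j *: gradq H (Q j, P j)
             - dW *: \sum_(j < s) bbar i j *: gradq h (Q j, P j) ;
  sprk_q : qk1 = qk + dt *: \sum_(i < s) alpha i *: gradp H (Q i, P i)
                    + dW *: \sum_(i < s) beta i *: gradp h (Q i, P i) ;
  sprk_p : pk1 = pk - dt *: \sum_(i < s) alpha i *: gradq H (Q i, P i)
                    - dW *: \sum_(i < s) beta i *: gradq h (Q i, P i)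
}.

Definition sprk_step (R : realType) (N s : nat) (H h : phase R N -> R)
    (a abar b bbar : 'I_s -> 'I_s -> R) (alpha beta : 'I_s -> R) (dt dW : R)
    (zk zk1 : phase R N) : Prop :=
  exists Q P : 'I_s -> 'rV[R]_N,
    sprk H h a abar b bbar alpha beta dt dW zk.1 zk.2 zk1.1 zk1.2 Q P.

Definition lagrange_integral (R : realType) (s : nat) (c : 'I_s -> R)
    (j : 'I_s) (x : R) : R :=
  \int[lebesgue_measure]_(tau in `[0, x]) (lagrange_poly c j).[tau].

Definition coef_a (R : realType) (s : nat) (c : 'I_s -> R)
    (i j : 'I_s) : R := lagrange_integral c j (c i).

Definition coef_abar (R : realType) (s : nat) (c alpha : 'I_s -> R)
    (i j : 'I_s) : R := alpha j * (alpha i - coef_a c j i) / alpha i.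

Definition coef_b (R : realType) (s : nat) (c alpha beta : 'I_s -> R)
    (i j : 'I_s) : R := beta j * coef_a c i j / alpha j.

Definition coef_bbar (R : realType) (s : nat) (c alpha beta : 'I_s -> R)
    (i j : 'I_s) : R := beta j * (alpha i - coef_a c j i) / alpha i.

(* Main.v *)
Require Import Defs.
From HB Require Import structures.
From mathcomp Require Import all_boot all_order all_algebra.
From mathcomp Require Import all_classical all_reals all_analysis.
From mathcomp Require Import ring.
Import Order.TTheory GRing.Theory Num.Theory.
Import numFieldNormedType.Exports.
Local Open Scope classical_set_scope.
Local Open Scope ring_scope.

Set Implicit Arguments.
Unset Strict Implicit.
Unset Printing Implicit Defensive.

(** Write [L_j] for the primitive, vanishing at [0], of the [j]-th Lagrange
    polynomial of the quadrature points, so that [a i j = L_j(c_i)] and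
    [alpha j = L_j(1)].  The argument is algebraic and pathwise: [dW] is an
    arbitrary real number in it, and the Hamiltonians enter only through the
    values of their gradients at the stages.

    Positions.  In rescaled time [t] in [[0, 1]], the curve [q_d] has degree at
    most [s], so its derivative is interpolated by its values at the [s]
    quadrature points, and integrating gives
    [q_d(t) = q_d(0) + sum_j L_j(t) D_j] with [D_j] the derivative at
    [c_j] ([qd_collocation]).  Since [alpha_j <> 0], the velocity equations
    give [D_j] in terms of the Hamiltonian gradients; evaluating at [c_i] and
    at [1] yields the Runge-Kutta equations for [Q_i] and [q_(k+1)].
    Conversely every choice of [q_d(0)] and of the [D_j] is realised by a curve
    ([qd_primitive]), which is unique; this gives the control values.

    Momenta.  The momentum equations say that a functional that is linear in
    the test polynomial [f],
    [sum_i alpha_i f'(c_i) P_i - sum_i f(c_i) F_i - f(1) p_(k+1) + f(0) p_k],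
    vanishes on the Lagrange basis of the control points, hence on all
    polynomials of degree at most [s].  Testing it on the basis formed by [1]
    and the [L_j] instead gives the update of [p_(k+1)] and, on dividing by
    [alpha_j], the stage equation for [P_j] ([weak_residual_eq0]). *)

(** * Primitives of polynomials and Lagrange interpolation *)

(** The primitive of [p] that vanishes at [0].  At [i = 0] the coefficient is
    [0], since division by [0] yields [0]. *)
Definition primitive_poly (R : numFieldType) (p : {poly R}) : {poly R} :=
  \poly_(i < (size p).+1) (p`_i.-1 / i%:R).

Lemma deriv_primitive_poly (R : numFieldType) (p : {poly R}) :
  (primitive_poly p)^`() = p.
Proof.
apply/polyP => i; rewrite coef_deriv coef_poly ltnS /=.
have [ip|pi] := ltnP i (size p); last by rewrite mul0rn nth_default.
by rewrite -[LHS]mulr_natr divfK // pnatr_eq0.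
Qed.

Lemma primitive_poly_at0 (R : numFieldType) (p : {poly R}) :
  (primitive_poly p).[0] = 0.
Proof. by rewrite horner_coef0 coef_poly /= invr0 mulr0. Qed.

Lemma deriv_eq0_polyC (R : numFieldType) (p : {poly R}) :
  p^`() = 0 -> p = p.[0]%:P.
Proof.
move=> dp0; apply/polyP => -[|i]; rewrite coefC ?horner_coef0 //=.
have /eqP := congr1 (fun q : {poly R} => q`_i) dp0.
by rewrite coef_deriv coef0 mulrn_eq0 /= => /eqP.
Qed.

Lemma size_lagrange_poly (R : realType) (n : nat) (x : 'I_n -> R) (i : 'I_n) :
  (size (lagrange_poly x i) <= n)%N.
Proof.
apply: leq_trans (size_poly_prod_leq _ _) _; rewrite leq_subLR -ltnS.
have -> : (#|[pred j | j != i]| = n.-1)%N by rewrite cardC1 card_ord.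
apply: (@leq_ltn_trans (\sum_(j < n | j != i) 2).+1%N).
  rewrite ltnS; apply: leq_sum => j _.
  by apply: leq_trans (size_scale_leq _ _) _; rewrite size_XsubC.
rewrite sum_nat_const cardC1 card_ord; case: n x i => [|n] x i; first by case: i.
by rewrite /= muln2 -addnn addnS !ltnS.
Qed.

Lemma lagrange_interpolation (R : realType) (n : nat) (x : 'I_n -> R)
    (p : {poly R}) :
  injective x -> (size p <= n)%N ->
  p = \sum_(i < n) p.[x i] *: lagrange_poly x i.
Proof.
move=> x_inj szp; apply/eqP; rewrite -subr_eq0; apply: contraT => nz.
have roots : all (root (p - \sum_(i < n) p.[x i] *: lagrange_poly x i))
    [seq x i | i <- enum 'I_n].
  apply/allP => _ /mapP[j _ ->]; rewrite rootE !hornerE horner_sum (bigD1 j) //=.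
  rewrite hornerZ lagrange_poly_node // eqxx mulr1 big1 ?addr0 ?subrr // => i ij.
  by rewrite hornerZ lagrange_poly_node // (negPf ij) mulr0.
have := max_poly_roots nz roots; rewrite map_inj_uniq // enum_uniq => /(_ isT).
rewrite size_map size_enum_ord ltnNge => /negP[].
apply: leq_trans (size_polyD _ _) _; rewrite geq_max szp size_polyN.
apply: (leq_trans (size_sum _ _ _)); apply/bigmax_leqP => i _.
exact: leq_trans (size_scale_leq _ _) (size_lagrange_poly _ _).
Qed.

(** A polynomial of degree at most [n] is determined by its value at [0] and
    by the values of its derivative at [n] distinct nodes. *)
Lemma lagrange_primitive_interpolation (R : realType) (n : nat)
    (c : 'I_n -> R) (p : {poly R}) :
  injective c -> (size p <= n.+1)%N ->
  p = p.[0]%:P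
      + \sum_(j < n) p^`().[c j] *: primitive_poly (lagrange_poly c j).
Proof.
move=> c_inj szp; apply/eqP; rewrite -subr_eq0 opprD addrA; apply/eqP.
set q := \sum_(j < n) _.
have q0 : q.[0] = 0.
  by rewrite horner_sum big1 // => j _; rewrite hornerZ primitive_poly_at0 mulr0.
rewrite [LHS]deriv_eq0_polyC; first by rewrite !hornerE q0 subr0 subrr.
have szd : (size p^`() <= n)%N.
  have [->|nz] := eqVneq p 0; first by rewrite deriv0 size_poly0.
  by rewrite -ltnS; apply: leq_trans szp; apply: lt_size_deriv.
rewrite !derivB derivC subr0 [p^`() in LHS](lagrange_interpolation c_inj szd).
rewrite /q raddf_sum /= -sumrB big1 // => j _.
by rewrite derivZ deriv_primitive_poly subrr.
Qed.

Lemma size_primitive_lagrange (R : realType) (n : nat) (c : 'I_n -> R)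
    (j : 'I_n) : (size (primitive_poly (lagrange_poly c j)) <= n.+1)%N.
Proof.
by apply: leq_trans (size_poly _ _) _; rewrite ltnS size_lagrange_poly.
Qed.

Lemma Rintegral_horner (R : realType) (p : {poly R}) (x : R) : 0 <= x ->
  \int[lebesgue_measure]_(t in `[0, x]) p.[t] = (primitive_poly p).[x].
Proof.
rewrite le_eqVlt => /predU1P[<-|x0].
  by rewrite set_itv1 Rintegral_set1 primitive_poly_at0.
rewrite /Rintegral (continuous_FTC2 (F := horner (primitive_poly p)) x0).
- by rewrite primitive_poly_at0 -EFinB subr0.
- by apply: continuous_subspaceT; exact: continuous_horner.
- split.
  + by move=> y _; apply: ex_derive.
  + by apply: cvg_at_right_filter; exact: continuous_horner.
  + by apply: cvg_at_left_filter; exact: continuous_horner.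
- by move=> y _; rewrite derive1E derive_val deriv_primitive_poly.
Qed.

Lemma lagrange_integralE (R : realType) (n : nat) (c : 'I_n -> R) (j : 'I_n)
    (x : R) : 0 <= x ->
  lagrange_integral c j x = (primitive_poly (lagrange_poly c j)).[x].
Proof. exact: Rintegral_horner. Qed.

(** * Weak form of the momentum equations *)

(** The residual, tested against the polynomial [f] and integrated by parts, of
    the balance of a momentum that goes from [p0] at time [0] to [p1] at time
    [1] and has the value [P i] at [c i].  The loss of momentum at [c i] is
    [F i], which already includes the quadrature weight. *)
Definition weak_residual (R : realType) (V : lmodType R) (n : nat)
    (alpha c : 'I_n -> R) (P F : 'I_n -> V) (p0 p1 : V) (f : {poly R}) : V :=
  \sum_(i < n) (alpha i * f^`().[c i]) *: P i - \sum_(i < n) f.[c i] *: F i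
  - (f.[1] *: p1 - f.[0] *: p0).

Lemma weak_residual_is_linear (R : realType) (V : lmodType R) (n : nat)
    (alpha c : 'I_n -> R) (P F : 'I_n -> V) (p0 p1 : V) :
  linear (weak_residual alpha c P F p0 p1).
Proof.
move=> a f g; rewrite /weak_residual !scalerBr !scaler_sumr !(hornerD, hornerZ).
have -> : \sum_(i < n) (alpha i * (a *: f + g)^`().[c i]) *: P i =
    \sum_(i < n) a *: ((alpha i * f^`().[c i]) *: P i)
    + \sum_(i < n) (alpha i * g^`().[c i]) *: P i.
  rewrite -big_split; apply: eq_bigr => i _ /=.
  by rewrite derivD derivZ !(hornerD, hornerZ) mulrDr mulrCA scalerDl scalerA.
have -> : \sum_(i < n) (a *: f + g).[c i] *: F i =
    \sum_(i < n) a *: (f.[c i] *: F i) + \sum_(i < n) g.[c i] *: F i.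
  rewrite -big_split; apply: eq_bigr => i _ /=.
  by rewrite !(hornerD, hornerZ) scalerDl scalerA.
have addrACA' (x y z t : V) : x + y - (z + t) = (x - z) + (y - t).
  by rewrite opprD addrACA.
have addACA (A A' B B' C C' : V) :
    A + A' - (B + B') - (C + C') = A - B - C + (A' - B' - C').
  by rewrite [A + A' - _]addrACA' [LHS]addrACA'.
rewrite !scalerDl -!scalerA -addACA.
by rewrite [a *: (_ *: p1) + _ - _]addrACA'.
Qed.

HB.instance Definition _ (R : realType) (V : lmodType R) (n : nat)
    (alpha c : 'I_n -> R) (P F : 'I_n -> V) (p0 p1 : V) :=
  GRing.isLinear.Build R {poly R} V *:%R (weak_residual alpha c P F p0 p1)
    (weak_residual_is_linear alpha c P F p0 p1).

Lemma weak_residual1 (R : realType) (V : lmodType R) (n : nat)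
    (alpha c : 'I_n -> R) (P F : 'I_n -> V) (p0 p1 : V) :
  weak_residual alpha c P F p0 p1 1 = p0 - \sum_(i < n) F i - p1.
Proof.
rewrite /weak_residual derivC !hornerC !scale1r opprB big1 => [|i _].
  rewrite (eq_bigr F) => [|i _]; last by rewrite hornerC scale1r.
  by rewrite sub0r addrA; congr (_ - _); rewrite addrC.
by rewrite horner0 mulr0 scale0r.
Qed.

Lemma weak_residual_primitive (R : realType) (V : lmodType R) (n : nat)
    (alpha c : 'I_n -> R) (P F : 'I_n -> V) (p0 p1 : V) (j : 'I_n) :
  injective c ->
  let L := primitive_poly (lagrange_poly c j) in
  weak_residual alpha c P F p0 p1 L =
  alpha j *: P j - \sum_(i < n) L.[c i] *: F i - L.[1] *: p1.
Proof.
move=> c_inj L; rewrite /weak_residual primitive_poly_at0 scale0r subr0.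
rewrite deriv_primitive_poly (bigD1 j) //= lagrange_poly_node // eqxx mulr1.
rewrite [\sum_(_ < _ | _) _]big1 ?addr0 // => i ij.
by rewrite lagrange_poly_node // eq_sym (negPf ij) mulr0 scale0r.
Qed.

(** The test polynomials may be taken from either basis of the polynomials of
    degree at most [n]: the Lagrange basis of the control points, or [1]
    together with the primitives of the Lagrange basis of the quadrature
    points.  The second choice makes the momentum equations explicit. *)
Lemma weak_residual_eq0 (R : realType) (V : lmodType R) (n : nat)
    (d : 'I_n.+1 -> R) (alpha c : 'I_n -> R) (P F : 'I_n -> V) (p0 p1 : V) :
  let L j := primitive_poly (lagrange_poly c j) in
  injective d -> injective c ->
  (forall j, alpha j = (L j).[1]) -> (forall j, alpha j != 0) ->
  (forall mu, weak_residual alpha c P F p0 p1 (lagrange_poly d mu) = 0) <->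
  p1 = p0 - \sum_(i < n) F i /\
  forall j, P j = p0 - \sum_(i < n) ((alpha j - (L j).[c i]) / alpha j) *: F i.
Proof.
move=> L d_inj c_inj alphaE alpha0.
set T := weak_residual alpha c P F p0 p1.
(* The stage equation for [P j] is the test against [L j], divided by
   [alpha j], once [p1] has been replaced by its value. *)
have TL j : p1 = p0 - \sum_(i < n) F i ->
    T (L j) = alpha j *: (P j - (p0 -
      \sum_(i < n) ((alpha j - (L j).[c i]) / alpha j) *: F i)).
  move=> p1E; rewrite /T weak_residual_primitive // -alphaE p1E.
  rewrite -addrA -opprD [RHS]scalerBr; congr (_ - _).
  rewrite !scalerBr addrCA; congr (_ + _).
  rewrite !scaler_sumr -!sumrN -big_split /=; apply: eq_bigr => i _.
  by rewrite scalerA mulrCA mulfV ?mulr1 // scalerBl opprB.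
split=> [T0|[p1E PE] mu].
  have Tf (f : {poly R}) : (size f <= n.+1)%N -> T f = 0.
    move=> szf; rewrite (lagrange_interpolation d_inj szf) /T raddf_sum.
    by rewrite big1 // => mu _ /=; rewrite linearZ /= -/T T0 scaler0.
  have p1E : p1 = p0 - \sum_(i < n) F i.
    by apply/esym/subr0_eq; rewrite -(weak_residual1 alpha c P) -/T Tf ?size_poly1.
  split=> // j; apply: subr0_eq.
  have /eqP := TL j p1E; rewrite Tf ?size_primitive_lagrange // eq_sym.
  by rewrite scaler_eq0 (negPf (alpha0 j)) => /eqP.
have szd := size_lagrange_poly d mu.
rewrite (lagrange_primitive_interpolation c_inj szd) /T raddfD /=.
rewrite -alg_polyC linearZ /= weak_residual1 -p1E subrr scaler0 add0r.
rewrite raddf_sum big1 // => j _ /=.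
by rewrite linearZ /= -/T TL // -PE subrr !scaler0.
Qed.

(** * The integrator and the Runge-Kutta method *)

(** The derivative at [c j], in the rescaled time of [[0, 1]], of the position
    curve that satisfies the velocity equations. *)
Definition stage_displacement (R : realType) (N n : nat) (H h : phase R N -> R)
    (alpha beta : 'I_n -> R) (dt dW : R) (Q P : 'I_n -> 'rV[R]_N)
    (j : 'I_n) : 'rV[R]_N :=
  dt *: gradp H (Q j, P j) + (dW * beta j / alpha j) *: gradp h (Q j, P j).

(** The loss of momentum at stage [j], quadrature weights included. *)
Definition stage_impulse (R : realType) (N n : nat) (H h : phase R N -> R)
    (alpha beta : 'I_n -> R) (dt dW : R) (Q P : 'I_n -> 'rV[R]_N)
    (j : 'I_n) : 'rV[R]_N :=
  (dt * alpha j) *: gradq H (Q j, P j) + (dW * beta j) *: gradq h (Q j, P j).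

Lemma momentum_sumE (R : realType) (N s r : nat) (H h : phase R N -> R)
    (d : 'I_s.+1 -> R) (alpha beta c : 'I_r -> R) (dt dW : R)
    (q : 'I_s.+1 -> 'rV[R]_N) (P : 'I_r -> 'rV[R]_N) (mu : 'I_s.+1) :
  let l := lagrange_poly d mu in
  momentum_sum H h d alpha beta c dt dW q P mu =
  \sum_(i < r) (alpha i * l^`().[c i]) *: P i
  - \sum_(i < r) l.[c i] *:
      stage_impulse H h alpha beta dt dW (fun j => qd d q (c j)) P i.
Proof.
rewrite /momentum_sum scaler_sumr -!sumrB; apply: eq_bigr => i _.
have mulrCC (x y z : R) : x * (y * z) = z * (y * x).
  by rewrite mulrA [RHS]mulrC (mulrC x).
rewrite scalerBr !scalerA -addrA -opprD /stage_impulse scalerDr !scalerA.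
by rewrite [alpha i * (dt * _)]mulrCC [dW * (_ * _)]mulrCC (mulrC (beta i)).
Qed.

Lemma lagrange_poly_first (R : realType) (s : nat) (d : 'I_s.+1 -> R)
    (mu : 'I_s.+1) : injective d -> d ord0 = 0 ->
  (lagrange_poly d mu).[0] = (mu == ord0)%:R.
Proof. by move=> d_inj {1}<-; rewrite lagrange_poly_node. Qed.

Lemma lagrange_poly_last (R : realType) (s : nat) (d : 'I_s.+1 -> R)
    (mu : 'I_s.+1) : injective d -> d ord_max = 1 ->
  (lagrange_poly d mu).[1] = (mu == ord_max)%:R.
Proof. by move=> d_inj {1}<-; rewrite lagrange_poly_node. Qed.

Lemma qd_node (R : realType) (N s : nat) (d : 'I_s.+1 -> R)
    (q : 'I_s.+1 -> 'rV[R]_N) (mu : 'I_s.+1) :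
  injective d -> qd d q (d mu) = q mu.
Proof.
move=> d_inj; rewrite /qd (bigD1 mu) //= lagrange_poly_node // eqxx scale1r.
rewrite big1 ?addr0 // => nu nu_mu.
by rewrite lagrange_poly_node // (negPf nu_mu) scale0r.
Qed.

(** As the velocity of [qd d q] has degree less than [s], it is the interpolant
    of its own values at the quadrature points. *)
Lemma qd_collocation (R : realType) (N s : nat) (d : 'I_s.+1 -> R)
    (c : 'I_s -> R) (q : 'I_s.+1 -> 'rV[R]_N) (t : R) :
  injective d -> injective c -> d ord0 = 0 ->
  qd d q t = q ord0 + \sum_(j < s) (primitive_poly (lagrange_poly c j)).[t] *:
    \sum_(mu < s.+1) (lagrange_poly d mu)^`().[c j] *: q mu.
Proof.
move=> d_inj c_inj d0; rewrite -[q ord0](qd_node q _ d_inj) d0 /qd.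
have -> : \sum_(j < s) (primitive_poly (lagrange_poly c j)).[t] *:
      \sum_(mu < s.+1) (lagrange_poly d mu)^`().[c j] *: q mu =
    \sum_(mu < s.+1) \sum_(j < s) ((lagrange_poly d mu)^`().[c j]
      * (primitive_poly (lagrange_poly c j)).[t]) *: q mu.
  rewrite exchange_big /=; apply: eq_bigr => j _; rewrite scaler_sumr.
  by apply: eq_bigr => mu _; rewrite scalerA mulrC.
rewrite -big_split; apply: eq_bigr => mu _ /=.
rewrite -scaler_suml -scalerDl; congr (_ *: _).
rewrite {1}(lagrange_primitive_interpolation c_inj (size_lagrange_poly d mu)).
rewrite hornerD hornerC horner_sum; congr (_ + _).
by apply: eq_bigr => j _; rewrite hornerZ.
Qed.

(** The control values [q] are those of the curve that starts at [q0] with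
    prescribed derivatives [D j] at the quadrature points. *)
Lemma qd_primitive (R : realType) (N s : nat) (d : 'I_s.+1 -> R)
    (c : 'I_s -> R) (q0 : 'rV[R]_N) (D : 'I_s -> 'rV[R]_N) :
  let L j := primitive_poly (lagrange_poly c j) in
  let q mu := q0 + \sum_(j < s) (L j).[d mu] *: D j in
  injective d -> injective c ->
  forall j, \sum_(mu < s.+1) (lagrange_poly d mu)^`().[c j] *: q mu = D j.
Proof.
move=> L q d_inj c_inj j.
have interp (f : {poly R}) : (size f <= s.+1)%N ->
    \sum_(mu < s.+1) (f.[d mu] * (lagrange_poly d mu)^`().[c j]) = f^`().[c j].
  move=> szf; rewrite [f in RHS](lagrange_interpolation d_inj szf).
  rewrite raddf_sum horner_sum; apply: eq_bigr => mu _.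
  by rewrite /= derivZ hornerZ.
have -> : \sum_(mu < s.+1) (lagrange_poly d mu)^`().[c j] *: q mu =
    (1 : {poly R})^`().[c j] *: q0 + \sum_(i < s) (L i)^`().[c j] *: D i.
  rewrite -interp ?size_poly1 // scaler_suml.
  under [\sum_(i < s) _]eq_bigr => i _.
    rewrite -interp ?size_primitive_lagrange // scaler_suml; over.
  rewrite exchange_big -big_split; apply: eq_bigr => mu _ /=.
  rewrite hornerC mul1r scalerDr scaler_sumr; congr (_ + _).
  by apply: eq_bigr => i _; rewrite scalerA mulrC.
rewrite derivC horner0 scale0r add0r (bigD1 j) //= deriv_primitive_poly.
rewrite lagrange_poly_node // eqxx scale1r big1 ?addr0 // => i ij.
by rewrite deriv_primitive_poly lagrange_poly_node // (negPf ij) scale0r.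
Qed.

(** The three kinds of momentum equations are instances of a single one,
    because the Lagrange polynomial of a control point takes at [0] and [1] the
    values that select [pk] for the first and [pk1] for the last one. *)
Lemma galerkin_viE (R : realType) (N s : nat) (H h : phase R N -> R)
    (d : 'I_s.+1 -> R) (alpha beta c : 'I_s -> R) (dt dW : R)
    (qk pk qk1 pk1 : 'rV[R]_N)
    (q : 'I_s.+1 -> 'rV[R]_N) (P : 'I_s -> 'rV[R]_N) :
  (0 < s)%N -> dt != 0 -> (forall i, alpha i != 0) ->
  injective d -> d ord0 = 0 -> d ord_max = 1 ->
  let Q i := qd d q (c i) in
  galerkin_vi H h d alpha beta c dt dW qk pk qk1 pk1 q P <->
  [/\ q ord0 = qk, q ord_max = qk1,
      forall j, \sum_(mu < s.+1) (lagrange_poly d mu)^`().[c j] *: q mu =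
        stage_displacement H h alpha beta dt dW Q P j
    & forall mu, weak_residual alpha c P
        (stage_impulse H h alpha beta dt dW Q P) pk pk1 (lagrange_poly d mu) = 0].
Proof.
move=> s0 dt0 alpha0 d_inj d0 d1 Q.
have ends : (ord_max == ord0 :> 'I_s.+1) = false.
  by rewrite -val_eqE /= eqn0Ngt s0.
have velocityE i :
    (alpha i *: dqd d dt q (c i) = alpha i *: gradp H (Q i, P i)
      + (beta i * (dW / dt)) *: gradp h (Q i, P i)) <->
    \sum_(mu < s.+1) (lagrange_poly d mu)^`().[c i] *: q mu =
      stage_displacement H h alpha beta dt dW Q P i.
  (* Both sides of the velocity equation carry the factor [alpha i / dt]. *)
  have u0 : alpha i / dt != 0 by rewrite mulf_neq0 ?invr_eq0.
  have -> : alpha i *: gradp H (Q i, P i)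
      + (beta i * (dW / dt)) *: gradp h (Q i, P i) =
      (alpha i / dt) *: stage_displacement H h alpha beta dt dW Q P i.
    rewrite /stage_displacement scalerDr !scalerA divfK //.
    by congr (_ + _ *: _); field; rewrite dt0 alpha0.
  by rewrite /dqd scalerA; split=> [/(scalerI u0)|->].
have residualE mu : weak_residual alpha c P
      (stage_impulse H h alpha beta dt dW Q P) pk pk1 (lagrange_poly d mu) =
    momentum_sum H h d alpha beta c dt dW q P mu
    - ((mu == ord_max)%:R *: pk1 - (mu == ord0)%:R *: pk).
  by rewrite momentum_sumE -(lagrange_poly_first mu d_inj d0)
    -(lagrange_poly_last mu d_inj d1).
split=> [[qs first inner last vel qe]|[qs qe vel T0]].
- split=> // [j|mu]; first exact/velocityE.
  rewrite residualE; have [->|mu0] := eqVneq mu ord0.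
    by rewrite -first eq_sym ends scale0r scale1r sub0r subrr.
  have [->|mus] := eqVneq mu ord_max.
    by rewrite -last scale0r scale1r subr0 subrr.
  rewrite -inner ?scale0r ?subrr //.
  by rewrite lt0n mu0 /= ltn_neqAle -ltnS ltn_ord andbT.
- split=> // [|mu /andP[mu0 mus]||i].
  + have /subr0_eq -> := etrans (esym (residualE ord0)) (T0 ord0).
    by rewrite eqxx eq_sym ends scale0r scale1r sub0r.
  + have /subr0_eq -> := etrans (esym (residualE mu)) (T0 mu).
    rewrite -!val_eqE /= (ltn_eqF mus) (gtn_eqF mu0) /=.
    by rewrite !scale0r subrr.
  + have /subr0_eq -> := etrans (esym (residualE ord_max)) (T0 ord_max).
    by rewrite eqxx ends scale0r scale1r subr0.
  + exact/velocityE.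
Qed.

(** In terms of stage displacements and impulses, the Runge-Kutta method has
    a single coefficient matrix for the positions and one for the momenta. *)
Lemma sprkE (R : realType) (N s : nat) (H h : phase R N -> R)
    (alpha beta c : 'I_s -> R) (dt dW : R) (qk pk qk1 pk1 : 'rV[R]_N)
    (Q P : 'I_s -> 'rV[R]_N) :
  (forall i, 0 <= c i) -> (forall i, alpha i != 0) ->
  let L j := primitive_poly (lagrange_poly c j) in
  let D := stage_displacement H h alpha beta dt dW Q P in
  let F := stage_impulse H h alpha beta dt dW Q P in
  sprk H h (coef_a c) (coef_abar c alpha) (coef_b c alpha beta)
    (coef_bbar c alpha beta) alpha beta dt dW qk pk qk1 pk1 Q P <->
  [/\ forall i, Q i = qk + \sum_(j < s) (L j).[c i] *: D j,
      forall i, P i =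
        pk - \sum_(j < s) ((alpha i - (L i).[c j]) / alpha i) *: F j,
      qk1 = qk + \sum_(j < s) alpha j *: D j
    & pk1 = pk - \sum_(j < s) F j].
Proof.
move=> c0 alpha0 L D F.
have coefE i j : coef_a c i j = (L j).[c i] by rewrite /coef_a lagrange_integralE.
have sumE (u v : 'I_s -> R) (x y z : 'I_s -> 'rV[R]_N) :
    (forall j, z j = dt *: (u j *: x j) + dW *: (v j *: y j)) ->
    \sum_(j < s) z j =
    dt *: (\sum_(j < s) u j *: x j) + dW *: (\sum_(j < s) v j *: y j).
  by move=> zE; rewrite !scaler_sumr -big_split; apply: eq_bigr => j _; exact: zE.
have QE i : \sum_(j < s) (L j).[c i] *: D j =
    dt *: (\sum_(j < s) coef_a c i j *: gradp H (Q j, P j))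
    + dW *: (\sum_(j < s) coef_b c alpha beta i j *: gradp h (Q j, P j)).
  apply: sumE => j; rewrite scalerDr !scalerA /coef_b coefE.
  by congr (_ *: _ + _ *: _); field; rewrite ?alpha0.
have PE i : \sum_(j < s) ((alpha i - (L i).[c j]) / alpha i) *: F j =
    dt *: (\sum_(j < s) coef_abar c alpha i j *: gradq H (Q j, P j))
    + dW *: (\sum_(j < s) coef_bbar c alpha beta i j *: gradq h (Q j, P j)).
  apply: sumE => j; rewrite scalerDr !scalerA /coef_abar /coef_bbar coefE.
  by congr (_ *: _ + _ *: _); field; rewrite ?alpha0.
have qE : \sum_(j < s) alpha j *: D j =
    dt *: (\sum_(j < s) alpha j *: gradp H (Q j, P j))
    + dW *: (\sum_(j < s) beta j *: gradp h (Q j, P j)).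
  apply: sumE => j; rewrite scalerDr !scalerA.
  by congr (_ *: _ + _ *: _); field; rewrite ?alpha0.
have pE : \sum_(j < s) F j =
    dt *: (\sum_(j < s) alpha j *: gradq H (Q j, P j))
    + dW *: (\sum_(j < s) beta j *: gradq h (Q j, P j)).
  by apply: sumE => j; rewrite !scalerA.
have addE (m x y z : 'rV[R]_N) : z = x + y -> m + x + y = m + z.
  by move=> ->; rewrite addrA.
have subE (m x y z : 'rV[R]_N) : z = x + y -> m - x - y = m - z.
  by move=> ->; rewrite opprD addrA.
split=> [[Qs Ps qs ps]|[Qs Ps qs ps]]; split=> [i|i||].
- exact: etrans (Qs i) (addE _ _ _ _ (QE i)).
- exact: etrans (Ps i) (subE _ _ _ _ (PE i)).
- exact: etrans qs (addE _ _ _ _ qE).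
- exact: etrans ps (subE _ _ _ _ pE).
- exact: etrans (Qs i) (esym (addE _ _ _ _ (QE i))).
- exact: etrans (Ps i) (esym (subE _ _ _ _ (PE i))).
- exact: etrans qs (esym (addE _ _ _ _ qE)).
- exact: etrans ps (esym (subE _ _ _ _ pE)).
Qed.

(** The stages of any solution of the integrator solve the Runge-Kutta
    system. *)
Lemma galerkin_vi_sprk (R : realType) (N s : nat) (H h : phase R N -> R)
    (d : 'I_s.+1 -> R) (alpha beta c : 'I_s -> R) (dt dW : R)
    (qk pk qk1 pk1 : 'rV[R]_N)
    (q : 'I_s.+1 -> 'rV[R]_N) (P : 'I_s -> 'rV[R]_N) :
  (0 < s)%N -> dt != 0 -> injective d -> d ord0 = 0 -> d ord_max = 1 ->
  injective c -> (forall i, 0 <= c i) ->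
  (forall i, alpha i = lagrange_integral c i 1) -> (forall i, alpha i != 0) ->
  galerkin_vi H h d alpha beta c dt dW qk pk qk1 pk1 q P ->
  sprk H h (coef_a c) (coef_abar c alpha) (coef_b c alpha beta)
    (coef_bbar c alpha beta) alpha beta dt dW qk pk qk1 pk1
    (fun i => qd d q (c i)) P.
Proof.
move=> s0 dt0 d_inj d0 d1 c_inj c0 alphaE alpha0.
have alphaL j : alpha j = (primitive_poly (lagrange_poly c j)).[1].
  by rewrite alphaE lagrange_integralE.
move=> /(galerkin_viE _ _ _ _ _ _ _ _ _ _ _ s0 dt0 alpha0 d_inj d0 d1).
case=> qs qe vel /(weak_residual_eq0 _ _ _ _ d_inj c_inj alphaL alpha0)[pE PE].
have qdE t : qd d q t = qk + \sum_(j < s) (primitive_poly (lagrange_poly c j)).[t]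
    *: stage_displacement H h alpha beta dt dW (fun i => qd d q (c i)) P j.
  rewrite (qd_collocation q t d_inj c_inj d0) qs; congr (_ + _).
  by apply: eq_bigr => j _; rewrite vel.
apply/sprkE => //; split=> //.
rewrite -qe -(qd_node q _ d_inj) d1 qdE; congr (_ + _).
by apply: eq_bigr => j _; rewrite alphaL.
Qed.

(** The control values are the values at the nodes [d mu] of the curve that
    starts at [qk] with the stage displacements as derivatives. *)
Lemma sprk_galerkin_vi (R : realType) (N s : nat) (H h : phase R N -> R)
    (d : 'I_s.+1 -> R) (alpha beta c : 'I_s -> R) (dt dW : R)
    (qk pk qk1 pk1 : 'rV[R]_N) (Q P : 'I_s -> 'rV[R]_N) :
  (0 < s)%N -> dt != 0 -> injective d -> d ord0 = 0 -> d ord_max = 1 ->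
  injective c -> (forall i, 0 <= c i) ->
  (forall i, alpha i = lagrange_integral c i 1) -> (forall i, alpha i != 0) ->
  sprk H h (coef_a c) (coef_abar c alpha) (coef_b c alpha beta)
    (coef_bbar c alpha beta) alpha beta dt dW qk pk qk1 pk1 Q P ->
  exists q : 'I_s.+1 -> 'rV[R]_N,
    galerkin_vi H h d alpha beta c dt dW qk pk qk1 pk1 q P
    /\ Q = (fun i => qd d q (c i)).
Proof.
move=> s0 dt0 d_inj d0 d1 c_inj c0 alphaE alpha0.
have alphaL j : alpha j = (primitive_poly (lagrange_poly c j)).[1].
  by rewrite alphaE lagrange_integralE.
move=> /sprkE[//|//|QE PE qE pE].
set D := stage_displacement H h alpha beta dt dW Q P.
pose q mu := qk + \sum_(j < s) (primitive_poly (lagrange_poly c j)).[d mu] *: D j.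
have qs : q ord0 = qk.
  rewrite /q d0 big1 ?addr0 // => j _.
  by rewrite primitive_poly_at0 scale0r.
have vel j : \sum_(mu < s.+1) (lagrange_poly d mu)^`().[c j] *: q mu = D j.
  exact: qd_primitive.
have Qqd : Q = (fun i => qd d q (c i)).
  apply/funext => i; rewrite (qd_collocation q _ d_inj c_inj d0) qs QE.
  by congr (_ + _); apply: eq_bigr => j _; rewrite vel.
exists q; split=> //; apply/galerkin_viE => //; rewrite -Qqd; split=> //.
  rewrite qE /q d1; congr (_ + _).
  by apply: eq_bigr => j _; rewrite alphaL.
exact/(weak_residual_eq0 _ _ _ _ d_inj c_inj alphaL alpha0).
Qed.

(** The control values are determined by the stages: the start condition and
    the stage velocities fix the whole curve. *)
Lemma galerkin_vi_inj (R : realType) (N s : nat) (H h : phase R N -> R)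
    (d : 'I_s.+1 -> R) (alpha beta c : 'I_s -> R) (dt dW : R)
    (qk pk qk1 pk1 : 'rV[R]_N)
    (q q' : 'I_s.+1 -> 'rV[R]_N) (P : 'I_s -> 'rV[R]_N) :
  (0 < s)%N -> dt != 0 -> (forall i, alpha i != 0) ->
  injective d -> d ord0 = 0 -> d ord_max = 1 -> injective c ->
  galerkin_vi H h d alpha beta c dt dW qk pk qk1 pk1 q P ->
  galerkin_vi H h d alpha beta c dt dW qk pk qk1 pk1 q' P ->
  (forall i, qd d q (c i) = qd d q' (c i)) -> q = q'.
Proof.
move=> s0 dt0 alpha0 d_inj d0 d1 c_inj.
move=> /galerkin_viE[//|//|//|//|//|//|qs _ vel _].
move=> /galerkin_viE[//|//|//|//|//|//|qs' _ vel' _] stages.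
apply/funext => mu; rewrite -(qd_node q mu d_inj) -(qd_node q' mu d_inj).
rewrite !(qd_collocation _ _ d_inj c_inj d0) qs qs'; congr (_ + _).
apply: eq_bigr => j _; rewrite vel vel'; congr (_ *: _).
by rewrite /stage_displacement stages.
Qed.

Theorem theorem3p4 (R : realType)
  (disp : measure_display) (Omega : measurableType disp)
  (Pr : probability Omega R) (W : R -> {RV Pr >-> R})
  (hW : standard_wiener W)
  (N : nat) (H h : phase R N -> R) (hH : C2 H) (hh : C2 h)
  (hA : lipschitz (ito_drift H h)) (hB : lipschitz (ito_diffusion h))
  (dt : R) (hdt : 0 < dt) (k : nat)
  (s : nat) (hs : (1 <= s)%N)
  (d : 'I_s.+1 -> R) (hd0 : d ord0 = 0) (hd1 : d ord_max = 1)
  (hd : forall mu nu : 'I_s.+1, (mu < nu)%N -> d mu < d nu)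
  (c : 'I_s -> R) (hc01 : forall i : 'I_s, 0 <= c i <= 1)
  (hc : forall i j : 'I_s, (i < j)%N -> c i < c j)
  (alpha beta : 'I_s -> R)
  (halpha : forall i : 'I_s, alpha i = lagrange_integral c i 1)
  (halpha0 : forall i : 'I_s, alpha i != 0)
  (omega : Omega) :
  let dW := wiener_increment W dt k omega in
  let a := coef_a c in
  let abar := coef_abar c alpha in
  let b := coef_b c alpha beta in
  let bbar := coef_bbar c alpha beta in
  (forall (qk pk qk1 pk1 : 'rV[R]_N) (Q P : 'I_s -> 'rV[R]_N),
     sprk H h a abar b bbar alpha beta dt dW qk pk qk1 pk1 Q P <->
     exists! q : 'I_s.+1 -> 'rV[R]_N,
       galerkin_vi H h d alpha beta c dt dW qk pk qk1 pk1 q P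
       /\ forall i : 'I_s, Q i = qd d q (c i))
  /\
  (forall zk zk1 : phase R N,
     galerkin_vi_step H h d alpha beta c dt dW zk zk1 <->
     sprk_step H h a abar b bbar alpha beta dt dW zk zk1).
Proof.
move=> dW a abar b bbar.
have dt0 : dt != 0 by rewrite gt_eqF.
have d_inj : injective d.
  move=> i j dij; apply/val_inj; case: (ltngtP i j) => // /hd.
    by rewrite dij ltxx.
  by rewrite dij ltxx.
have c_inj : injective c.
  move=> i j cij; apply/val_inj; case: (ltngtP i j) => // /hc.
    by rewrite cij ltxx.
  by rewrite cij ltxx.
have c0 i : 0 <= c i by case/andP: (hc01 i).
split=> [qk pk qk1 pk1 Q P|zk zk1]; split.
- move=> /(sprk_galerkin_vi hs dt0 d_inj hd0 hd1 c_inj c0 halpha halpha0).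
  case=> q [vi QE]; exists q; split; first by rewrite QE.
  move=> q' [vi' QE'].
  apply: (galerkin_vi_inj hs dt0 _ d_inj hd0 hd1 c_inj vi vi') => // i.
  by rewrite -QE' QE.
- case=> q [[vi QE] _]; have -> : Q = (fun i => qd d q (c i)) by exact/funext.
  exact: galerkin_vi_sprk vi.
- by case=> q [P vi]; exists (fun i => qd d q (c i)), P; exact: galerkin_vi_sprk vi.
- case=> Q [P /(sprk_galerkin_vi hs dt0 d_inj hd0 hd1 c_inj c0 halpha halpha0)].
  by case=> q [vi _]; exists q, P.
Qed.
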